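(* Let $T$ be a rising tree with discriminator $D=4$ or a leveling tree, so that $T$ is rational or irrational. Then (a) $T$ has repeated numbers if and only if it is rational; (b) $T$ has uniqueness if and only if it is irrational.
   Context: A real Markov tree $T$ with base triple $(s_0,u_0,t_0)\in\mathbb R^3$ is a rooted planar trivalent tree (the root has degree 1, all other vertices degree 3) whose complementary regions carry real labels; the root edge has the region $s_0$ on its left, $t_0$ on its right, and leads to the region $u_0$; and for every non-root edge, with regions $s,t$ on its two sides and regions $r,u$ at its two ends, $r+u=st$. The discriminator is $D=s_0^2+u_0^2+t_0^2-s_0u_0t_0$; the labels $r,s,t$ at every non-root vertex satisfy $r^2+s^2+t^2-rst=D$. Edge directions: a non-root edge directed from end region $r$ to end region $u$ has label $u-r$; the root edge directed away from the root has label $2u_0-s_0t_0$. The positive direction of an edge is the one making its label positive; edges with label $0$ are undirected. $T$ is rising if all labels are $>2$ and all edges are positively directed away from the root except for those on a finite (possibly empty) simple path starting at the root. $T$ is leveling if $D=4$ and either $2<s_0$, $2<t_0$, $2\le u_0<s_0t_0/2$, or else the base triple has the form $(2,t_0,t_0)$ or $(s_0,s_0,2)$ for some $s_0,t_0>2$. Let $\rho(x)=\cosh^{-1}(x/2)$ for $x\ge2$. $T$ is rational if $\rho(s)/\rho(t)$ is rational for all pairs of adjacent regions (regions sharing an edge) with labels $s>2$, $t>2$; it is irrational if $\rho(s)/\rho(t)$ is irrational for all such pairs. (Every rising tree with $D=4$ and every leveling tree is either rational or irrational.) $T$ has repeated numbers if the same label appears in two different regions of $T$. $T$ has uniqueness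 if, considering the triples of labels meeting at the non-root vertices of $T$, each listed in increasing order, the maximal element determines the other two: whenever $a\le b\le c$ and $a'\le b'\le c$ are two such triples, then $a=a'$ and $b=b'$. *)

(* Defs.v *)
From Stdlib Require Export Reals List Permutation QArith Qreals.
From Stdlib Require Import Lra.
Export ListNotations.
Open Scope R_scope.

(** * The rooted planar trivalent tree *)

Inductive turn : Set := turn_left | turn_right.

(* An edge is the sequence of turns leading to it from the root, the LAST turn
   at the head of the list; [] is the root edge.  Every edge has a unique
   endpoint away from the root, so the same words also name the non-root
   vertices. *)
Definition edge := list turn.

(* [ahead e] is the region met head-on when [e] is followed away from the root.
   The regions on the two sides of the root edge are distinct. *)
Inductive region : Set :=
| left_of_root
| right_of_root
| ahead (e : edge).

Fixpoint left_region (e : edge) : region :=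
  match e with
  | [] => left_of_root
  | turn_left :: e' => left_region e'
  | turn_right :: e' => ahead e'
  end.

Fixpoint right_region (e : edge) : region :=
  match e with
  | [] => right_of_root
  | turn_left :: e' => ahead e'
  | turn_right :: e' => right_region e'
  end.

(* The region at the end nearer to the root of the non-root edge [d :: e]. *)
Definition behind (d : turn) (e : edge) : region :=
  match d with
  | turn_left => right_region e
  | turn_right => left_region e
  end.

Definition adjacent (A B : region) : Prop :=
  exists e : edge,
    (A = left_region e /\ B = right_region e) \/
    (A = right_region e /\ B = left_region e).

(* The list of edges of a finite simple path starting at the root, the edge
   farthest from the root first. *)
Inductive root_path : list edge -> Prop :=
| root_path_empty : root_path []
| root_path_root : root_path [[]]
| root_path_step (d : turn) (e : edge) (P : list edge) :
    root_path (e :: P) -> root_path ((d :: e) :: e :: P).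

(** * Real Markov trees *)

Record markov_tree := {
  label :> region -> R;
  markov_rule : forall (d : turn) (e : edge),
    label (behind d e) + label (ahead (d :: e)) =
    label (left_region (d :: e)) * label (right_region (d :: e))
}.

Definition base_s (T : markov_tree) : R := T left_of_root.
Definition base_u (T : markov_tree) : R := T (ahead []).
Definition base_t (T : markov_tree) : R := T right_of_root.

Definition discriminant (T : markov_tree) : R :=
  base_s T ^ 2 + base_u T ^ 2 + base_t T ^ 2 - base_s T * base_u T * base_t T.

(* The label of an edge directed away from the root. *)
Definition edge_label (T : markov_tree) (e : edge) : R :=
  match e with
  | [] => 2 * base_u T - base_s T * base_t T
  | d :: e' => T (ahead e) - T (behind d e')
  end.

Definition rising (T : markov_tree) : Prop :=
  (forall A : region, 2 < T A) /\
  exists P : list edge,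
    root_path P /\ forall e : edge, ~ In e P -> 0 < edge_label T e.

Definition leveling (T : markov_tree) : Prop :=
  discriminant T = 4 /\
  ((2 < base_s T /\ 2 < base_t T /\
    2 <= base_u T /\ base_u T < base_s T * base_t T / 2)
   \/ (base_s T = 2 /\ base_u T = base_t T /\ 2 < base_t T)
   \/ (base_t T = 2 /\ base_u T = base_s T /\ 2 < base_s T)).

(** * Rationality *)

Definition arcosh (x : R) : R := ln (x + sqrt (x ^ 2 - 1)).

Lemma arcosh_nonneg (x : R) : 1 <= x -> 0 <= arcosh x.
Proof.
  intros Hx. unfold arcosh. pose proof (sqrt_pos (x ^ 2 - 1)).
  rewrite <- ln_1.
  destruct (Req_dec (x + sqrt (x ^ 2 - 1)) 1) as [-> | Hne]; [lra|].
  apply Rlt_le, ln_increasing; lra.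
Qed.

Lemma cosh_arcosh (x : R) : 1 <= x -> cosh (arcosh x) = x.
Proof.
  intros Hx. unfold cosh, arcosh. pose proof (sqrt_pos (x ^ 2 - 1)) as H.
  assert (Hs : sqrt (x ^ 2 - 1) * sqrt (x ^ 2 - 1) = x ^ 2 - 1)
    by (apply sqrt_sqrt; nra).
  rewrite exp_Ropp, exp_ln by lra.
  set (r := sqrt (x ^ 2 - 1)) in *.
  assert (Hi : / (x + r) = x - r)
    by (apply (Rmult_eq_reg_l (x + r)); [rewrite Rinv_r; nra | lra]).
  rewrite Hi. lra.
Qed.

Definition rho (x : R) : R := arcosh (x / 2).

Definition is_rational (x : R) : Prop := exists q : Q, x = Q2R q.

Definition rational_tree (T : markov_tree) : Prop :=
  forall A B : region, adjacent A B -> 2 < T A -> 2 < T B ->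
    is_rational (rho (T A) / rho (T B)).

Definition irrational_tree (T : markov_tree) : Prop :=
  forall A B : region, adjacent A B -> 2 < T A -> 2 < T B ->
    ~ is_rational (rho (T A) / rho (T B)).

(** * Repeated numbers and uniqueness *)

Definition has_repeated_numbers (T : markov_tree) : Prop :=
  exists A B : region, A <> B /\ T A = T B.

(* [a <= b <= c] are the labels around some non-root vertex. *)
Definition sorted_triple (T : markov_tree) (a b c : R) : Prop :=
  a <= b /\ b <= c /\
  exists v : edge,
    Permutation [a; b; c]
      [T (left_region v); T (ahead v); T (right_region v)].

Definition has_uniqueness (T : markov_tree) : Prop :=
  forall a b a' b' c : R,
    sorted_triple T a b c -> sorted_triple T a' b' c -> a = a' /\ b = b'.

(* Main.v *)
(* Since D = 4, the labels are 2 cosh of a linear form: the region with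
   Stern–Brocot vector (x, y) has label 2 cosh (x a + y b), with signs chosen so
   that this holds for the base triple, because 2 cosh f * 2 cosh g =
   2 cosh (f + g) + 2 cosh (f - g).  If a and b are linearly independent over Q,
   distinct regions have distinct labels, since the tree reaches each primitive
   vector once and never both v and -v.  If a repeated label never occurs, then
   the maximum of a triple determines its region C; the two other regions are
   neighbours of C, so their heights are ±y modulo the height of C, which fixes
   the triple.  If a and b are commensurable, a Euclidean descent along the edges
   whose sides have heights of opposite signs reaches an edge whose sides have
   heights p c and q c with p, q > 0, and two vertices beyond that edge have the
   same maximum but different triples.  Thus both repeated numbers and
   non-uniqueness are equivalent to commensurability of a and b, which by
   determinants ±1 is rationality of the tree. *)
Require Import Defs.
From Stdlib Require Import Reals.
From Stdlib Require Import ZArith Lia Lra Classical.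
Open Scope R_scope.

(** * Hyperbolic cosine *)

Lemma cosh_opp (x : R) : cosh (- x) = cosh x.
Proof. unfold cosh. rewrite Ropp_involutive. lra. Qed.

Lemma cosh_Rabs (x : R) : cosh (Rabs x) = cosh x.
Proof. unfold Rabs. destruct (Rcase_abs x); [apply cosh_opp | reflexivity]. Qed.

Lemma cosh_prod (x y : R) : 2 * cosh x * cosh y = cosh (x + y) + cosh (x - y).
Proof.
  unfold cosh, Rminus. rewrite !Ropp_plus_distr, !exp_plus, Ropp_involutive. lra.
Qed.

(** With [E = exp x] and [F = exp y], the difference of [F + / F] and [E + / E] factors as
    [(F - E) * (1 - / E * / F)], and both factors are positive since [1 <= E < F]. *)
Lemma cosh_lt_nonneg (x y : R) : 0 <= x < y -> cosh x < cosh y.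
Proof.
  intros [Hx Hxy].
  assert (H1 : 1 <= exp x) by (pose proof (exp_ineq1_le x); lra).
  assert (H2 : exp x < exp y) by (apply exp_increasing; lra).
  unfold cosh. rewrite !exp_Ropp.
  set (E := exp x) in *. set (F := exp y) in *.
  assert (HE : E * / E = 1) by (apply Rinv_r; lra).
  assert (HF : F * / F = 1) by (apply Rinv_r; lra).
  assert (0 < / E) by (apply Rinv_0_lt_compat; lra).
  assert (0 < / F) by (apply Rinv_0_lt_compat; lra).
  set (e := / E) in *. set (f := / F) in *.
  assert (e <= 1) by nra. assert (f < 1) by nra.
  assert (E + e < F + f); [|lra].
  replace (F + f) with (E + e + (F - E) * (1 - e * f)).
  - assert (0 < 1 - e * f) by nra. nra.
  - replace ((F - E) * (1 - e * f)) with (F - E - e * (F * f) + f * (E * e)) by ring.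
    rewrite HE, HF. ring.
Qed.

Lemma cosh_lt_Rabs (x y : R) : cosh x < cosh y <-> Rabs x < Rabs y.
Proof.
  assert (H : forall u v, Rabs u < Rabs v -> cosh u < cosh v).
  { intros u v Huv. rewrite <- (cosh_Rabs u), <- (cosh_Rabs v).
    apply cosh_lt_nonneg. split; [apply Rabs_pos | exact Huv]. }
  split; [|apply H]. intros Hc.
  destruct (Rtotal_order (Rabs x) (Rabs y)) as [? | [He | Hg]]; [assumption | |].
  - rewrite <- (cosh_Rabs x), He, cosh_Rabs in Hc. lra.
  - apply H in Hg. lra.
Qed.

Lemma cosh_le_Rabs (x y : R) : cosh x <= cosh y <-> Rabs x <= Rabs y.
Proof. pose proof (cosh_lt_Rabs y x). split; intros; lra. Qed.

Lemma cosh_eq_Rabs (x y : R) : cosh x = cosh y <-> Rabs x = Rabs y.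
Proof.
  pose proof (cosh_le_Rabs x y). pose proof (cosh_le_Rabs y x).
  split; intros; apply Rle_antisym; lra.
Qed.

Lemma cosh_gt_1 (x : R) : 1 < cosh x <-> x <> 0.
Proof.
  rewrite <- cosh_0, cosh_lt_Rabs, Rabs_R0. split.
  - intros H ->. rewrite Rabs_R0 in H. lra.
  - apply Rabs_pos_lt.
Qed.

Lemma rho_cosh (x : R) : rho (2 * cosh x) = Rabs x.
Proof.
  unfold rho. replace (2 * cosh x / 2) with (cosh x) by lra.
  assert (H1 : 1 <= cosh x).
  { rewrite <- cosh_0, cosh_le_Rabs, Rabs_R0. apply Rabs_pos. }
  rewrite <- (Rabs_pos_eq _ (arcosh_nonneg _ H1)).
  apply cosh_eq_Rabs, cosh_arcosh, H1.
Qed.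

(** * Stern–Brocot coordinates of regions *)

(** The vectors of the left and right side of an edge are computed together, since each turn
    replaces one of them by the sum of both. *)
Fixpoint coords_frame (e : edge) : (Z * Z) * (Z * Z) :=
  match e with
  | [] => ((1, 0), (0, 1))%Z
  | turn_left :: e' =>
      let '((a, b), (c, d)) := coords_frame e' in ((a, b), (a + c, b + d))%Z
  | turn_right :: e' =>
      let '((a, b), (c, d)) := coords_frame e' in ((a + c, b + d), (c, d))%Z
  end.

Definition coords (A : region) : Z * Z :=
  match A with
  | left_of_root => (1, 0)%Z
  | right_of_root => (0, 1)%Z
  | ahead e =>
      let '((a, b), (c, d)) := coords_frame e in (a + c, b + d)%Z
  end.

Definition det (A B : region) : Z :=
  (fst (coords A) * snd (coords B) - snd (coords A) * fst (coords B))%Z.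

Lemma coords_frameE (e : edge) :
  coords_frame e = (coords (left_region e), coords (right_region e)).
Proof.
  induction e as [|[] e IH]; simpl; [reflexivity | |];
    rewrite IH; destruct (coords (left_region e)), (coords (right_region e));
    reflexivity.
Qed.

Lemma fst_coords_ahead (e : edge) :
  fst (coords (ahead e)) =
  (fst (coords (left_region e)) + fst (coords (right_region e)))%Z.
Proof.
  simpl. rewrite coords_frameE.
  destruct (coords (left_region e)), (coords (right_region e)); reflexivity.
Qed.

Lemma snd_coords_ahead (e : edge) :
  snd (coords (ahead e)) =
  (snd (coords (left_region e)) + snd (coords (right_region e)))%Z.
Proof.
  simpl. rewrite coords_frameE.
  destruct (coords (left_region e)), (coords (right_region e)); reflexivity.
Qed.

Lemma coords_sides_bounds (e : edge) :
  (1 <= fst (coords (left_region e)) /\ 0 <= snd (coords (left_region e)) /\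
   0 <= fst (coords (right_region e)) /\ 1 <= snd (coords (right_region e)))%Z.
Proof.
  induction e as [|[] e IH]; cbn [left_region right_region];
    rewrite ?fst_coords_ahead, ?snd_coords_ahead; simpl; lia.
Qed.

Lemma det_sides (e : edge) : det (left_region e) (right_region e) = 1%Z.
Proof.
  unfold det.
  induction e as [|[] e IH]; cbn [left_region right_region];
    rewrite ?fst_coords_ahead, ?snd_coords_ahead; simpl; lia.
Qed.

(** The last turn can be read off: a left turn makes the right vector exceed the left one by the old
    right vector, and a right turn does the reverse. The bounds exclude confusion of the two, or
    with the root edge. *)
Lemma coords_sides_inj (e e' : edge) :
  coords (left_region e) = coords (left_region e') ->
  coords (right_region e) = coords (right_region e') -> e = e'.
Proof.
  revert e'. induction e as [|d e IH]; intros [|d' e'] HL HR; [reflexivity | | |];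
    apply (f_equal fst) in HL as HL1; apply (f_equal snd) in HL as HL2;
    apply (f_equal fst) in HR as HR1; apply (f_equal snd) in HR as HR2;
    clear HL HR.
  1: pose proof (coords_sides_bounds e').
  2: pose proof (coords_sides_bounds e).
  3: pose proof (coords_sides_bounds e'); pose proof (coords_sides_bounds e).
  all: try destruct d; try destruct d';
    cbn [left_region right_region] in *;
    rewrite ?fst_coords_ahead, ?snd_coords_ahead in *;
    cbn [coords fst snd] in *; try lia.
  all: f_equal; apply IH; apply injective_projections; lia.
Qed.

Lemma coords_inj (A B : region) : coords A = coords B -> A = B.
Proof.
  intros H.
  apply (f_equal fst) in H as H1; apply (f_equal snd) in H as H2; clear H.
  destruct A as [| |e], B as [| |e'];
    rewrite ?fst_coords_ahead, ?snd_coords_ahead in *;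
    try pose proof (coords_sides_bounds e) as He;
    try pose proof (coords_sides_bounds e') as He';
    cbn [coords fst snd] in H1, H2; try reflexivity; try lia.
  pose proof (det_sides e) as D. pose proof (det_sides e') as D'. unfold det in D, D'.
  set (a := fst (coords (left_region e))) in *.
  set (b := snd (coords (left_region e))) in *.
  set (c := fst (coords (right_region e))) in *.
  set (d := snd (coords (right_region e))) in *.
  set (a' := fst (coords (left_region e'))) in *.
  set (b' := snd (coords (left_region e'))) in *.
  set (c' := fst (coords (right_region e'))) in *.
  set (d' := snd (coords (right_region e'))) in *.
  (* [a * y - b * x = 1 = a' * y - b' * x] for the common vector [(x, y)], so
     [(a, b)] and [(a', b')] differ by a multiple [k * (x, y)]; but
     [1 <= a, a' <= x]. *)
  assert (E : ((a - a') * (b + d) = (b - b') * (a + c))%Z).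
  { apply Zminus_eq.
    replace ((a - a') * (b + d) - (b - b') * (a + c))%Z with
      ((a * d - b * c) - (a' * (b + d) - b' * (a + c)))%Z by ring.
    rewrite H1, H2, D. lia. }
  (* Taking the determinant of [(a - a', b - b') = k * (x, y)] with [(c, d)] isolates [k], because
     [a * d - b * c = 1]. *)
  set (k := ((a - a') * d - (b - b') * c)%Z).
  assert (Ka : (a - a' = k * (a + c))%Z).
  { transitivity ((a - a') * (a * d - b * c))%Z; [rewrite D; ring|].
    unfold k. transitivity ((a - a') * d * (a + c) - c * ((a - a') * (b + d)))%Z;
      [ring | rewrite E; ring]. }
  assert (Kb : (b - b' = k * (b + d))%Z).
  { transitivity ((b - b') * (a * d - b * c))%Z; [rewrite D; ring|].
    unfold k. transitivity (d * ((b - b') * (a + c)) - (b - b') * c * (b + d))%Z;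
      [ring | rewrite <- E; ring]. }
  assert (K0 : k = 0%Z).
  { clearbody k. clear - Ka He He' H1.
    assert (k < 1)%Z by (apply Z.nle_gt; intros ?; nia).
    assert (-1 < k)%Z by (apply Z.nle_gt; intros ?; nia). lia. }
  rewrite K0 in Ka, Kb.
  f_equal. apply coords_sides_inj; apply injective_projections; lia.
Qed.

(** * Labels as hyperbolic cosines of a linear form *)

Definition height (a b : R) (A : region) : R :=
  IZR (fst (coords A)) * a + IZR (snd (coords A)) * b.

Lemma height_ahead (a b : R) (e : edge) :
  height a b (ahead e) = height a b (left_region e) + height a b (right_region e).
Proof. unfold height. rewrite fst_coords_ahead, snd_coords_ahead, !plus_IZR. ring. Qed.

(** Cramer's rule for three plane vectors, carried through the linear form. When [det A B] is a unit
    it expresses [C] integrally in [A] and [B]. *)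
Lemma height_det (a b : R) (A B C : region) :
  IZR (det A B) * height a b C =
  IZR (det C B) * height a b A + IZR (det A C) * height a b B.
Proof. unfold det, height. rewrite !minus_IZR, !mult_IZR. ring. Qed.

Definition incommensurable (a b : R) : Prop :=
  forall i j : Z, IZR i * a + IZR j * b = 0 -> i = 0%Z /\ j = 0%Z.

Definition cosh_labelled (T : markov_tree) (a b : R) : Prop :=
  forall A : region, T A = 2 * cosh (height a b A).

Lemma cosh_labelled_base (T : markov_tree) (a b : R) :
  T left_of_root = 2 * cosh a -> T right_of_root = 2 * cosh b ->
  T (ahead []) = 2 * cosh (a + b) -> cosh_labelled T a b.
Proof.
  intros Hs Ht Hu.
  (* The induction carries all three regions at the far vertex of [e], since the rule at the next
     edge computes the new label from exactly these. The region behind has the difference of the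
     side heights, the one ahead their sum. *)
  assert (H : forall e, T (left_region e) = 2 * cosh (height a b (left_region e)) /\
    T (right_region e) = 2 * cosh (height a b (right_region e)) /\
    T (ahead e) = 2 * cosh (height a b (ahead e))).
  { induction e as [|d e (IL & IR & IA)].
    - rewrite height_ahead. unfold height; simpl.
      replace (1 * a + 0 * b) with a by ring. replace (0 * a + 1 * b) with b by ring.
      auto.
    - pose proof (markov_rule T d e) as M. pose proof (height_ahead a b e) as HA.
      pose proof (height_ahead a b (d :: e)) as HA'.
      destruct d; cbn [left_region right_region behind] in *;
        (split; [assumption | split; [assumption|]]);
        set (x := height a b (left_region e)) in *;
        set (y := height a b (right_region e)) in *;
        rewrite HA', HA in *; rewrite IL, IR, IA in M.
      + pose proof (cosh_prod (x + y) x) as P.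
        replace (x + y - x) with y in P by ring.
        rewrite (Rplus_comm x (x + y)). lra.
      + pose proof (cosh_prod (x + y) y) as P.
        replace (x + y - y) with x in P by ring. lra. }
  intros [| |e]; [apply (H []) | apply (H []) | apply (H e)].
Qed.

(** For fixed [s] and [t], [D = 4] is a quadratic equation in [u] with roots [2 cosh (a + b)] and
    [2 cosh (a - b)]. The second root is absorbed by changing the sign of [b]. *)
Lemma cosh_labelled_exists (T : markov_tree) :
  2 <= base_s T -> 2 <= base_t T -> discriminant T = 4 ->
  exists a b, cosh_labelled T a b.
Proof.
  unfold discriminant, base_s, base_t, base_u. intros Hs Ht D.
  pose proof (cosh_arcosh (T left_of_root / 2) ltac:(lra)) as Ea.
  pose proof (cosh_arcosh (T right_of_root / 2) ltac:(lra)) as Eb.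
  set (a := arcosh (T left_of_root / 2)) in *.
  set (b := arcosh (T right_of_root / 2)) in *.
  assert (Ha : T left_of_root = 2 * cosh a) by lra.
  assert (Hb : T right_of_root = 2 * cosh b) by lra.
  assert (F : (T (ahead []) - 2 * cosh (a + b)) * (T (ahead []) - 2 * cosh (a - b)) = 0).
  (* Vieta: [P2] yields the product [s^2 + t^2 - 4] of the roots, and the later [P] their sum
     [s t]. *)
  { assert (P2 : 4 * (cosh (a + b) * cosh (a - b)) =
      4 * (cosh a ^ 2 + cosh b ^ 2 - 1)).
    { pose proof (cosh_prod (a + b) (a - b)) as P.
      replace (a + b + (a - b)) with (a + a) in P by ring.
      replace (a + b - (a - b)) with (b + b) in P by ring.
      pose proof (cosh_prod a a) as Pa. pose proof (cosh_prod b b) as Pb.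
      replace (a - a) with 0 in Pa by ring. replace (b - b) with 0 in Pb by ring.
      rewrite cosh_0 in Pa, Pb. nra. }
    pose proof (cosh_prod a b) as P. rewrite Ha, Hb in D. nra. }
  apply Rmult_integral in F as [F | F].
  - exists a, b. apply cosh_labelled_base; lra.
  - exists a, (- b). apply cosh_labelled_base; rewrite ?cosh_opp; [lra | lra |].
    unfold Rminus in *. lra.
Qed.

(** * Incommensurable heights *)

Lemma incommensurable_no_repeats (T : markov_tree) (a b : R) :
  cosh_labelled T a b -> incommensurable a b -> ~ has_repeated_numbers T.
Proof.
  intros HT Hab (A & B & N & E). apply N. rewrite !HT in E.
  assert (Rabs (height a b A) = Rabs (height a b B)) as E'
    by (apply cosh_eq_Rabs; lra).
  (* Nonzero vectors in the closed first quadrant never sum to zero, which rules out opposite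
     heights. *)
  assert (pos : forall C, (0 <= fst (coords C) /\ 0 <= snd (coords C) /\
    1 <= fst (coords C) + snd (coords C))%Z).
  { intros [| |e]; [simpl; lia | simpl; lia |].
    rewrite fst_coords_ahead, snd_coords_ahead. pose proof (coords_sides_bounds e). lia. }
  pose proof (pos A). pose proof (pos B).
  assert (S : height a b A - height a b B = 0 \/ height a b A + height a b B = 0).
  { revert E'. unfold Rabs.
    destruct (Rcase_abs (height a b A)), (Rcase_abs (height a b B)); lra. }
  unfold height in S. destruct S as [S | S].
  - destruct (Hab (fst (coords A) - fst (coords B))%Z
                  (snd (coords A) - snd (coords B))%Z).
    { rewrite !minus_IZR. lra. }
    apply coords_inj, injective_projections; lia.
  - destruct (Hab (fst (coords A) + fst (coords B))%Z
                  (snd (coords A) + snd (coords B))%Z).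
    { rewrite !plus_IZR. lra. }
    lia.
Qed.

Lemma Permutation_length_3_inv {X : Type} (x y z a b c : X) :
  Permutation [x; y; z] [a; b; c] ->
  In [x; y; z]
    [[a; b; c]; [a; c; b]; [b; a; c]; [b; c; a]; [c; a; b]; [c; b; a]].
Proof.
  intros H.
  destruct (Permutation_in x H (or_introl eq_refl)) as [-> | [-> | [-> | []]]].
  - apply Permutation_cons_inv, Permutation_sym, Permutation_length_2_inv in H
      as [[= -> ->] | [= -> ->]]; simpl; auto 10.
  - assert (H' : Permutation (x :: [y; z]) ([a] ++ x :: [c])) by exact H.
    apply Permutation_cons_app_inv, Permutation_sym, Permutation_length_2_inv in H'
      as [[= -> ->] | [= -> ->]]; simpl; auto 10.
  - assert (H' : Permutation (x :: [y; z]) ([a; b] ++ x :: [])) by exact H.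
    apply Permutation_cons_app_inv, Permutation_sym, Permutation_length_2_inv in H'
      as [[= -> ->] | [= -> ->]]; simpl; auto 10.
Qed.

(** One of the three heights is the sum of the other two, so up to signs the largest absolute value
    is the sum of the smaller ones. *)
Lemma sorted_triple_heights (T : markov_tree) (a b α β γ : R) :
  cosh_labelled T a b -> sorted_triple T α β γ ->
  exists A B C, T A = α /\ T B = β /\ T C = γ /\ Z.abs (det C A) = 1%Z /\
    Rabs (height a b A) <= Rabs (height a b B) /\
    Rabs (height a b C) = Rabs (height a b A) + Rabs (height a b B).
Proof.
  intros HT (H1 & H2 & v & Hp).
  (* The permutation of labels is lifted to one of regions, so that heights and determinants become
     available. *)
  change [T (left_region v); T (ahead v); T (right_region v)]
    with (map T [left_region v; ahead v; right_region v]) in Hp.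
  apply Permutation_map_inv in Hp as (l & El & Hl).
  destruct l as [|A [|B [|C [|? ?]]]]; try discriminate El.
  injection El as -> -> ->. exists A, B, C.
  rewrite !HT in H1, H2.
  assert (AB : Rabs (height a b A) <= Rabs (height a b B)) by (apply cosh_le_Rabs; lra).
  assert (BC : Rabs (height a b B) <= Rabs (height a b C)) by (apply cosh_le_Rabs; lra).
  pose proof (height_ahead a b v) as HA. pose proof (det_sides v) as D.
  pose proof (fst_coords_ahead v) as F1. pose proof (snd_coords_ahead v) as F2.
  unfold det in *.
  apply Permutation_sym, Permutation_length_3_inv in Hl.
  do 3 (split; [reflexivity|]).
  repeat destruct Hl as [[= <- <- <-] | Hl]; [.. | destruct Hl];
    (split; [rewrite ?F1, ?F2; lia | split; [assumption|]]);
    clear - AB BC HA; revert AB BC; unfold Rabs;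
    repeat destruct (Rcase_abs _); lra.
Qed.

Lemma no_repeats_uniqueness (T : markov_tree) (a b : R) :
  cosh_labelled T a b -> ~ has_repeated_numbers T -> has_uniqueness T.
Proof.
  intros HT Hrep α β α' β' γ H H'.
  destruct (sorted_triple_heights _ _ _ _ _ _ HT H)
    as (A & B & C & <- & <- & <- & D & AB & S).
  destruct (sorted_triple_heights _ _ _ _ _ _ HT H')
    as (A' & B' & C' & <- & <- & EC & D' & AB' & S').
  assert (C' = C) as ->.
  { apply NNPP. intros N. apply Hrep. exists C', C. auto. }
  rewrite !HT.
  (* Both [A] and [A'] are neighbours of [C], so their heights agree up to sign
     and an integer multiple of the height of [C]; both are at most half of the
     latter in absolute value. *)
  assert (HE : Rabs (height a b A) = Rabs (height a b A')).
  { pose proof (height_det a b C A A') as K.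
    assert (exists k : Z, height a b A' = height a b A + IZR k * height a b C \/
      height a b A' = - height a b A + IZR k * height a b C) as [k Hk].
    (* This is [K] multiplied by the sign [det C A]. *)
    { exists (det C A * det A' A)%Z. rewrite mult_IZR.
      assert (det C A = 1%Z \/ det C A = (-1)%Z) as [E | E] by lia;
      assert (det C A' = 1%Z \/ det C A' = (-1)%Z) as [E' | E'] by lia;
      rewrite E, E' in *; lra. }
    set (x := height a b C) in *. set (y := height a b A) in *.
    set (y' := height a b A') in *.
    assert (Hy : 2 * Rabs y <= Rabs x) by lra.
    assert (Hy' : 2 * Rabs y' <= Rabs x) by lra.
    (* For [k <> 0], [|k x| >= |x|] while [|y|] and [|y'|] are at most [|x| / 2], so both equal
       [|x| / 2]. *)
    destruct (Z.eq_dec k 0) as [-> | Hk0].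
    { clear - Hk. unfold Rabs; repeat destruct (Rcase_abs _); lra. }
    assert (Rabs x <= Rabs (IZR k * x)).
    { rewrite Rabs_mult, <- abs_IZR.
      pose proof (IZR_le 1 (Z.abs k) ltac:(lia)). pose proof (Rabs_pos x). nra. }
    set (w := IZR k * x) in *. clearbody w. clear - Hk Hy Hy' H0.
    revert Hy Hy' H0; unfold Rabs; repeat destruct (Rcase_abs _); lra. }
  assert (HB : Rabs (height a b B) = Rabs (height a b B')) by lra.
  apply cosh_eq_Rabs in HE. apply cosh_eq_Rabs in HB. lra.
Qed.

(** * Commensurable heights *)

Lemma uniqueness_sides (T : markov_tree) (e e' : edge) :
  has_uniqueness T -> T (ahead e) = T (ahead e') ->
  T (left_region e) <= T (ahead e) -> T (right_region e) <= T (ahead e) ->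
  T (left_region e') <= T (ahead e') -> T (right_region e') <= T (ahead e') ->
  T (left_region e) = T (left_region e') \/ T (left_region e) = T (right_region e').
Proof.
  assert (S : forall e,
    T (left_region e) <= T (ahead e) -> T (right_region e) <= T (ahead e) ->
    sorted_triple T (T (left_region e)) (T (right_region e)) (T (ahead e)) \/
    sorted_triple T (T (right_region e)) (T (left_region e)) (T (ahead e))).
  { intros v HL HR.
    destruct (Rle_dec (T (left_region v)) (T (right_region v)));
      [left | right]; (split; [lra | split; [lra|]]); exists v.
    - apply perm_skip, perm_swap.
    - eapply perm_trans; [apply perm_swap | apply perm_skip, perm_swap]. }
  intros U E HL HR HL' HR'.
  destruct (S e HL HR) as [H | H], (S e' HL' HR') as [H' | H'];
    rewrite <- E in H'; destruct (U _ _ _ _ _ H H'); auto.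
Qed.

Lemma nonunique_of_positive (T : markov_tree) (a b c : R) (e : edge) (p q : nat) :
  cosh_labelled T a b -> c <> 0 -> (0 < p)%nat -> (0 < q)%nat ->
  height a b (left_region e) = INR p * c ->
  height a b (right_region e) = INR q * c -> ~ has_uniqueness T.
Proof.
  intros HT Hc.
  assert (main : forall e p q, (0 < p)%nat -> (0 < q)%nat -> p <> q ->
    height a b (left_region e) = INR p * c ->
    height a b (right_region e) = INR q * c -> ~ has_uniqueness T).
  { clear e p q. intros e p q Hp Hq Hpq HL HR U.
    (* With [L] and [R] the vectors of the regions beside [e], the regions
       [L + (p + 1) R] and [(q + 1) L + R] both have height [(p + q + p q) c],
       but their parent pairs have heights [(p + p q) c, q c] and
       [p c, (q + p q) c]. *)
    assert (R1 : forall n, height a b (left_region (repeat turn_right n ++ e)) =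
        INR (p + n * q) * c /\
      height a b (right_region (repeat turn_right n ++ e)) = INR q * c).
    { induction n as [|n [IL IR]]; cbn [repeat app left_region right_region].
      - split; [|assumption]. rewrite HL, Nat.add_0_r. reflexivity.
      - split; [|assumption]. rewrite height_ahead, IL, IR, <- Rmult_plus_distr_r, <- plus_INR.
        do 2 f_equal. lia. }
    assert (R2 : forall n, height a b (left_region (repeat turn_left n ++ e)) =
        INR p * c /\
      height a b (right_region (repeat turn_left n ++ e)) = INR (q + n * p) * c).
    { induction n as [|n [IL IR]]; cbn [repeat app left_region right_region].
      - split; [assumption|]. rewrite HR, Nat.add_0_r. reflexivity.
      - split; [assumption|]. rewrite height_ahead, IL, IR, <- Rmult_plus_distr_r, <- plus_INR.
        do 2 f_equal. lia. }
    destruct (R1 p) as [L1 L2], (R2 q) as [L3 L4].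
    pose proof (height_ahead a b (repeat turn_right p ++ e)) as A1.
    pose proof (height_ahead a b (repeat turn_left q ++ e)) as A2.
    rewrite L1, L2, <- Rmult_plus_distr_r, <- plus_INR in A1.
    rewrite L3, L4, <- Rmult_plus_distr_r, <- plus_INR in A2.
    assert (le : forall m n, (m <= n)%nat -> 2 * cosh (INR m * c) <= 2 * cosh (INR n * c)).
    { intros m n Hmn. apply Rmult_le_compat_l; [lra|].
      apply cosh_le_Rabs. rewrite !Rabs_mult, !(Rabs_pos_eq (INR _)) by apply pos_INR.
      apply Rmult_le_compat_r; [apply Rabs_pos | apply le_INR, Hmn]. }
    assert (inj : forall m n, 2 * cosh (INR m * c) = 2 * cosh (INR n * c) -> m = n).
    { intros m n Hmn. apply INR_eq. apply (Rmult_eq_reg_r (Rabs c)).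
      - rewrite <- (Rabs_pos_eq (INR m)), <- (Rabs_pos_eq (INR n)), <- !Rabs_mult
          by apply pos_INR.
        apply cosh_eq_Rabs. lra.
      - apply Rabs_no_R0, Hc. }
    destruct (uniqueness_sides T (repeat turn_right p ++ e) (repeat turn_left q ++ e) U)
      as [H | H]; rewrite !HT, ?A1, ?A2, ?L1, ?L2, ?L3, ?L4 in *;
      try (apply le; nia).
    - do 4 f_equal. lia.
    - apply inj in H. nia.
    - apply inj in H. nia. }
  intros Hp Hq HL HR.
  (* For [p = q] the two parent pairs in [main] carry the same heights; one left turn first changes
     the multiples to [p] and [2 p]. *)
  destruct (Nat.eq_dec p q) as [E | N]; [|exact (main e p q Hp Hq N HL HR)].
  apply (main (turn_left :: e) p (p + q)%nat); try lia; [exact HL|].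
  simpl right_region. rewrite height_ahead, HL, HR, plus_INR. ring.
Qed.

(** Subtractive Euclidean algorithm: the region ahead has height [(p - q) c], and turning so that it
    replaces the larger side lowers [p + q]. When one side reaches zero, a turn puts equal nonzero
    heights on both sides. *)
Lemma nonunique_of_opposite (T : markov_tree) (a b c : R) (e : edge) (p q : nat) :
  cosh_labelled T a b -> c <> 0 -> (0 < p + q)%nat ->
  height a b (left_region e) = INR p * c ->
  height a b (right_region e) = - (INR q * c) -> ~ has_uniqueness T.
Proof.
  intros HT Hc.
  remember (p + q)%nat as n eqn:Hn.
  revert e p q Hn. induction (Nat.lt_wf_0 n) as [n _ IH]. intros e p q Hn Hpos HL HR.
  pose proof (height_ahead a b e) as HA. rewrite HL, HR in HA.
  destruct (Nat.eq_dec p 0) as [-> | Hp].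
  { apply (nonunique_of_positive T a b (- c) (turn_right :: e) q q); try lia;
      cbn [left_region right_region]; rewrite ?HA, ?HR; simpl; try lra. exact HT. }
  destruct (Nat.eq_dec q 0) as [-> | Hq].
  { apply (nonunique_of_positive T a b c (turn_left :: e) p p); try lia;
      cbn [left_region right_region]; rewrite ?HA, ?HL; simpl; try lra. exact HT. }
  destruct (le_lt_dec q p) as [Hqp | Hqp].
  - apply (IH p ltac:(lia) (turn_right :: e) (p - q)%nat q); try lia;
      cbn [left_region right_region]; rewrite ?HA, ?HR; rewrite ?minus_INR by lia; lra.
  - apply (IH q ltac:(lia) (turn_left :: e) p (q - p)%nat); try lia;
      cbn [left_region right_region]; rewrite ?HA, ?HL; rewrite ?minus_INR by lia; lra.
Qed.

Lemma commensurable_not_unique (T : markov_tree) (c : R) (P Q : Z) :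
  cosh_labelled T (IZR P * c) (IZR Q * c) -> c <> 0 -> P <> 0%Z \/ Q <> 0%Z ->
  ~ has_uniqueness T.
Proof.
  intros HT Hc HPQ.
  assert (HL : height (IZR P * c) (IZR Q * c) (left_region []) = IZR P * c)
    by (unfold height; simpl; ring).
  assert (HR : height (IZR P * c) (IZR Q * c) (right_region []) = IZR Q * c)
    by (unfold height; simpl; ring).
  assert (pos : forall n, (0 <= n)%Z -> INR (Z.to_nat n) = IZR n)
    by (intros; rewrite INR_IZR_INZ, Z2Nat.id; auto).
  assert (neg : forall n, (n <= 0)%Z -> INR (Z.to_nat (- n)) = - IZR n)
    by (intros; rewrite pos, opp_IZR; [reflexivity | lia]).
  destruct (Z_lt_le_dec P 0) as [HP | HP], (Z_lt_le_dec Q 0) as [HQ | HQ].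
  - apply (nonunique_of_positive T _ _ (- c) [] (Z.to_nat (- P)) (Z.to_nat (- Q)) HT);
      rewrite ?HL, ?HR, ?neg by lia; try lra; lia.
  - apply (nonunique_of_opposite T _ _ (- c) [] (Z.to_nat (- P)) (Z.to_nat Q) HT);
      rewrite ?HL, ?HR, ?neg, ?pos by lia; try lra; lia.
  - apply (nonunique_of_opposite T _ _ c [] (Z.to_nat P) (Z.to_nat (- Q)) HT);
      rewrite ?HL, ?HR, ?neg, ?pos by lia; try lra; lia.
  (* A zero height is not a positive multiple of [c], so it is treated as a degenerate case of
     opposite signs. *)
  - destruct (Z.eq_dec P 0) as [P0 | P0], (Z.eq_dec Q 0) as [Q0 | Q0]; [lia | | |].
    + apply (nonunique_of_opposite T _ _ (- c) [] 0 (Z.to_nat Q) HT);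
        rewrite ?HL, ?HR, ?pos by lia; subst; simpl; try lra; lia.
    + apply (nonunique_of_opposite T _ _ c [] (Z.to_nat P) 0 HT);
        rewrite ?HL, ?HR, ?pos by lia; subst; simpl; try lra; lia.
    + apply (nonunique_of_positive T _ _ c [] (Z.to_nat P) (Z.to_nat Q) HT);
        rewrite ?HL, ?HR, ?pos by lia; try lra; lia.
Qed.

Lemma not_incommensurable_inv (a b : R) :
  a <> 0 \/ b <> 0 -> ~ incommensurable a b ->
  exists (c : R) (P Q : Z), c <> 0 /\ (P <> 0%Z \/ Q <> 0%Z) /\
    a = IZR P * c /\ b = IZR Q * c.
Proof.
  intros Hab H.
  apply not_all_ex_not in H as [i H]. apply not_all_ex_not in H as [j H].
  apply imply_to_and in H as [H Hij].
  (* The relation [i a + j b = 0] makes [(a, b)] a multiple of [(j, - i)]. *)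
  assert (K : exists c : R, a = IZR j * c /\ b = IZR (- i) * c).
  { destruct (Z.eq_dec j 0) as [-> | Hj].
    - assert (Hi : IZR i <> 0) by (apply not_0_IZR; tauto).
      exists (- (b / IZR i)). rewrite opp_IZR. split; [|field; exact Hi].
      apply (Rmult_eq_reg_l (IZR i)); [|exact Hi]. rewrite Rmult_0_l in *. lra.
    - apply not_0_IZR in Hj. exists (a / IZR j). rewrite opp_IZR.
      split; [field; exact Hj|].
      apply (Rmult_eq_reg_l (IZR j)); [|exact Hj].
      transitivity (- (IZR i * a)); [lra | field; exact Hj]. }
  destruct K as (c & Ea & Eb). exists c, j, (- i)%Z.
  split; [intros -> ; lra | split; [lia | auto]].
Qed.

(** * Rationality *)

Lemma is_rational_IZR_div (m n : Z) : n <> 0%Z -> is_rational (IZR m / IZR n).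
Proof.
  intros Hn. destruct n as [|p|p]; [congruence | |].
  - exists (m # p)%Q. reflexivity.
  - exists (- m # p)%Q. unfold Q2R; simpl.
    change (Z.neg p) with (- Z.pos p)%Z. rewrite !opp_IZR.
    field. apply not_0_IZR. discriminate.
Qed.

Lemma cosh_labelled_gt_2 (T : markov_tree) (a b : R) (A : region) :
  cosh_labelled T a b -> 2 < T A <-> height a b A <> 0.
Proof. intros HT. rewrite HT, <- cosh_gt_1. lra. Qed.

Lemma adjacent_det (A B : region) : adjacent A B -> Z.abs (det A B) = 1%Z.
Proof.
  intros (e & [[-> ->] | [-> ->]]); pose proof (det_sides e); unfold det in *; lia.
Qed.

Lemma commensurable_rational (T : markov_tree) (c : R) (P Q : Z) :
  cosh_labelled T (IZR P * c) (IZR Q * c) -> c <> 0 -> rational_tree T.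
Proof.
  intros HT Hc A B _ HA HB.
  apply (cosh_labelled_gt_2 _ _ _ _ HT) in HB.
  rewrite !HT, !rho_cosh.
  assert (K : forall C, exists n : Z, height (IZR P * c) (IZR Q * c) C = IZR n * c).
  { intros C. exists (fst (coords C) * P + snd (coords C) * Q)%Z.
    unfold height. rewrite plus_IZR, !mult_IZR. ring. }
  destruct (K A) as [m ->]. destruct (K B) as [n E]. rewrite E in *.
  assert (Hn : n <> 0%Z) by (intros ->; lra).
  rewrite !Rabs_mult, <- !abs_IZR.
  replace (IZR (Z.abs m) * Rabs c / (IZR (Z.abs n) * Rabs c))
    with (IZR (Z.abs m) / IZR (Z.abs n)).
  - apply is_rational_IZR_div. lia.
  - field. split; [apply Rabs_no_R0, Hc | apply not_0_IZR; lia].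
Qed.

(** Keeps rationality and irrationality from both holding vacuously. If one base height is zero, one
    turn gives an edge with the other base height on both sides. *)
Lemma exists_adjacent_gt_2 (T : markov_tree) (a b : R) :
  cosh_labelled T a b -> a <> 0 \/ b <> 0 ->
  exists A B, adjacent A B /\ 2 < T A /\ 2 < T B.
Proof.
  intros HT Hab.
  assert (HL : height a b (left_region []) = a) by (unfold height; simpl; ring).
  assert (HR : height a b (right_region []) = b) by (unfold height; simpl; ring).
  pose proof (height_ahead a b []) as HA. rewrite HL, HR in HA.
  destruct (Req_dec a 0) as [Ha | Ha], (Req_dec b 0) as [Hb | Hb].
  - tauto.
  - exists (left_region [turn_right]), (right_region [turn_right]).
    split; [exists [turn_right]; auto|].
    rewrite !(cosh_labelled_gt_2 _ _ _ _ HT). simpl in *. lra.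
  - exists (left_region [turn_left]), (right_region [turn_left]).
    split; [exists [turn_left]; auto|].
    rewrite !(cosh_labelled_gt_2 _ _ _ _ HT). simpl in *. lra.
  - exists (left_region []), (right_region []). split; [exists []; auto|].
    rewrite !(cosh_labelled_gt_2 _ _ _ _ HT). simpl in *. lra.
Qed.

Lemma incommensurable_irrational (T : markov_tree) (a b : R) :
  cosh_labelled T a b -> incommensurable a b -> irrational_tree T.
Proof.
  intros HT Hab A B Hadj HA HB [q Hq].
  apply (cosh_labelled_gt_2 _ _ _ _ HT) in HB.
  rewrite !HT, !rho_cosh in Hq. unfold Q2R in Hq.
  set (n := Qnum q) in *. set (d := Zpos (Qden q)) in *.
  assert (Hd : IZR d <> 0) by (apply not_0_IZR; discriminate).
  assert (E : IZR d * Rabs (height a b A) = IZR n * Rabs (height a b B)).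
  { pose proof (Rabs_no_R0 _ HB).
    replace (Rabs (height a b A)) with
      (Rabs (height a b A) / Rabs (height a b B) * Rabs (height a b B))
      by (field; assumption).
    rewrite Hq. field. exact Hd. }
  assert (exists k : Z, IZR d * height a b A + IZR k * height a b B = 0) as [k Hk].
  { revert E. unfold Rabs.
    destruct (Rcase_abs (height a b A)), (Rcase_abs (height a b B)); intros E;
      ((exists n; lra) || (exists (- n)%Z; rewrite opp_IZR; lra)). }
  destruct (Hab (d * fst (coords A) + k * fst (coords B))%Z
                (d * snd (coords A) + k * snd (coords B))%Z) as [E1 E2].
  { rewrite !plus_IZR, !mult_IZR. unfold height in Hk. lra. }
  apply adjacent_det in Hadj.
  (* The vector [d A + k B] vanishes; its determinant with [B] leaves only [d * det A B], which is
     nonzero. *)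
  assert (d * det A B = 0)%Z.
  { unfold det.
    transitivity ((d * fst (coords A) + k * fst (coords B)) * snd (coords B)
      - (d * snd (coords A) + k * snd (coords B)) * fst (coords B))%Z; [ring|].
    rewrite E1, E2. ring. }
  unfold d in *. nia.
Qed.

Lemma rational_not_irrational (T : markov_tree) (a b : R) :
  cosh_labelled T a b -> a <> 0 \/ b <> 0 -> rational_tree T -> ~ irrational_tree T.
Proof.
  intros HT Hab HR HI.
  destruct (exists_adjacent_gt_2 T a b HT Hab) as (A & B & H & HA & HB).
  exact (HI A B H HA HB (HR A B H HA HB)).
Qed.

Theorem theorem10p11 (T : markov_tree)
  (hT : (rising T /\ discriminant T = 4) \/ leveling T) :
  (has_repeated_numbers T <-> rational_tree T) /\
  (has_uniqueness T <-> irrational_tree T).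
Proof.
  assert (H : discriminant T = 4 /\ 2 <= base_s T /\ 2 <= base_t T /\
    (2 < base_s T \/ 2 < base_t T)).
  { destruct hT as [[[Hr _] D] | [D Hl]]; (split; [exact D|]).
    - pose proof (Hr left_of_root). pose proof (Hr right_of_root).
      unfold base_s, base_t. lra.
    - lra. }
  destruct H as (D & Hs & Ht & Hst).
  destruct (cosh_labelled_exists T Hs Ht D) as (a & b & HT).
  assert (Hab : a <> 0 \/ b <> 0).
  { unfold base_s, base_t in Hst. rewrite !(cosh_labelled_gt_2 _ _ _ _ HT) in Hst.
    destruct (Req_dec a 0), (Req_dec b 0); auto.
    exfalso. unfold height in Hst. simpl in Hst. subst. lra. }
  pose proof (rational_not_irrational T a b HT Hab) as HRI.
  destruct (classic (incommensurable a b)) as [Hi | Hi].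
  - pose proof (incommensurable_no_repeats T a b HT Hi).
    pose proof (no_repeats_uniqueness T a b HT).
    pose proof (incommensurable_irrational T a b HT Hi).
    tauto.
  - destruct (not_incommensurable_inv a b Hab Hi) as (c & P & Q & Hc & HPQ & -> & ->).
    pose proof (commensurable_not_unique T c P Q HT Hc HPQ).
    pose proof (commensurable_rational T c P Q HT Hc).
    (* Repeated numbers come by contraposition: without them the tree would have uniqueness. *)
    pose proof (no_repeats_uniqueness T _ _ HT).
    destruct (classic (has_repeated_numbers T)); tauto.
Qed.
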